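(* The graph $H_9$ satisfies $$d^*\left(\mathrm{Forb}(H_9)\right)\le\frac{3-\sqrt{5}}{4}.$$ Moreover, this value $\frac{3-\sqrt5}{4}$ occurs at the intersection of the curves $g_{K'}(p)$ and $g_{K''}(p)$, $p\in[0,1]$, where $K'$ is the colored regularity graph consisting of two black vertices and a gray edge, and $K''$ is the colored regularity graph consisting of four white vertices, one black edge and five gray edges.
   Context: All graphs are finite and simple. $H_9$ is the graph with vertex set $\{0,1,\dots,8\}$ in which distinct vertices $i,j$ are adjacent if and only if $i-j\in\{\pm1,\pm2\}\pmod 9$ or both $i$ and $j$ are congruent to $0$ modulo $3$ (that is, the square $C_9^2$ of the 9-cycle together with the triangle on $\{0,3,6\}$). $\mathrm{Forb}(H)$ is the class of graphs with no induced copy of $H$. For a class of graphs $\mathcal{P}$ and a graph $G$, $\mathrm{Dist}(G,\mathcal{P})=\min\{|E(F)\triangle E(G)| : F\in\mathcal{P},\,V(F)=V(G)\}$ and $\mathrm{Dist}(n,\mathcal{P})=\max\{\mathrm{Dist}(G,\mathcal{P}):|V(G)|=n\}$. For a hereditary property $\mathcal{H}$ (a class of graphs closed under deletion of vertices), $d^*(\mathcal{H})=\lim_{n\to\infty}\mathrm{Dist}(n,\mathcal{H})/\binom{n}{2}$ (this limit exists). A colored regularity graph (CRG) $K$ is a finite complete graph whose vertices are each colored white or black and whose edges are each colored white, gray or black. For a CRG $K$ on $k$ vertices and $p\in[0,1]$, let $\mathbf{M}_K(p)$ be the symmetric $k\times k$ matrix indexed by $V(K)$ whose diagonal entry at $v$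 is $p$ if $v$ is white and $1-p$ if $v$ is black, and whose off-diagonal entry at $(u,v)$ is $p$, $1-p$ or $0$ according to whether the edge $\{u,v\}$ is white, black or gray. Then $$g_K(p)=\min\{\mathbf{u}^T\mathbf{M}_K(p)\mathbf{u} : \mathbf{u}\in\mathbb{R}^k,\ \mathbf{u}^T\mathbf{1}=1,\ \mathbf{u}\ge\mathbf{0}\}.$$ *)

(* Defs.v *)
From HB Require Import structures.
From mathcomp Require Import all_boot all_order all_algebra.
From mathcomp Require Import all_classical all_reals all_analysis.

Set Implicit Arguments.
Unset Strict Implicit.
Unset Printing Implicit Defensive.

Import Order.TTheory GRing.Theory Num.Theory.
Import numFieldNormedType.Exports.
Local Open Scope ring_scope.

Record sgraph (T : finType) := SGraph {
  edges : {set {set T}};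
  edges_card2 : [forall e in edges, #|e| == 2%N] }.

HB.instance Definition _ (T : finType) := [isSub for @edges T].
HB.instance Definition _ (T : finType) := [Finite of sgraph T by <:].

Definition adj (T : finType) (G : sgraph T) (x y : T) : bool :=
  [set x; y]%SET \in edges G.

Definition rel_edges (T : finType) (r : rel T) : {set {set T}} :=
  [set [set u.1; u.2] | u : T * T & (u.1 != u.2) && r u.1 u.2]%SET.

Lemma rel_edges_card2 (T : finType) (r : rel T) :
  [forall e in rel_edges r, #|e| == 2%N].
Proof.
apply/forall_inP => e /imsetP[[x y]]; rewrite inE /= => /andP[xy _] ->.
by rewrite cards2 xy.
Qed.

Definition graph_of_rel (T : finType) (r : rel T) : sgraph T :=
  SGraph (rel_edges_card2 r).

(* Subtraction and the constants are those of the ring of integers mod 9. *)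
Definition H9 : sgraph 'Z_9 :=
  graph_of_rel (fun i j : 'Z_9 =>
    (i - j \in [:: 1; -1; 2; -2]) || (3 %| i)%N && (3 %| j)%N).

Definition graph_class := forall T : finType, pred (sgraph T).

Definition induced_copy (U T : finType) (H : sgraph U) (G : sgraph T)
    (f : {ffun U -> T}) : bool :=
  injectiveb f && [forall x, forall y, adj G (f x) (f y) == adj H x y].

Definition Forb (U : finType) (H : sgraph U) : graph_class :=
  fun T G => ~~ [exists f : {ffun U -> T}, induced_copy H G f].

Definition edit_count (T : finType) (F G : sgraph T) : nat :=
  #|(edges F :\: edges G) :|: (edges G :\: edges F)|%SET.

(* The neutral element 'C(#|T|, 2) bounds every edit_count F G, so it does not
   affect the minimum unless P has no graph on T at all. *)
Definition Dist (T : finType) (G : sgraph T) (P : graph_class) : nat :=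
  \big[minn/'C(#|T|, 2)]_(F : sgraph T | P T F) edit_count F G.

Definition Dist_max (n : nat) (P : graph_class) : nat :=
  \max_(G : sgraph 'I_n) Dist G P.

Definition edit_ratio (R : realType) (P : graph_class) : R^nat :=
  fun n => (Dist_max n P)%:R / ('C(n, 2))%:R.

Definition dstar (R : realType) (P : graph_class) : R :=
  limn (edit_ratio R P).

Inductive vcolor := VWhite | VBlack.
Inductive ecolor := EWhite | EGray | EBlack.

(* The values of [ecol] on the diagonal are irrelevant. *)
Record crg (k : nat) := CRG {
  vcol : 'I_k -> vcolor;
  ecol : 'I_k -> 'I_k -> ecolor;
  ecol_sym : forall u v, ecol u v = ecol v u }.

Definition crg_mx (R : realType) (k : nat) (K : crg k) (p : R) : 'M[R]_k :=
  \matrix_(u, v)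
    if u == v then match vcol K u with VWhite => p | VBlack => 1 - p end
    else match ecol K u v with EWhite => p | EBlack => 1 - p | EGray => 0 end.

Definition simplex (R : realType) (k : nat) : set 'cV[R]_k :=
  [set u : 'cV[R]_k | \sum_i u i 0 = 1 /\ forall i, 0 <= u i 0]%classic.

(* The minimum of A; the default 0 is returned only when A has no least
   element. *)
Definition set_min (R : realType) (A : set R) : R :=
  xget 0 (A `&` lbound A)%classic.

Definition gK (R : realType) (k : nat) (K : crg k) (p : R) : R :=
  set_min [set (u^T *m crg_mx K p *m u) 0 0 | u in @simplex R k]%classic.

Definition two_black : crg 2 :=
  @CRG 2 (fun=> VBlack) (fun _ _ => EGray) (fun _ _ => erefl).

Definition four_white_ecol (u v : 'I_4) : ecolor :=
  if (u < 2)%N && (v < 2)%N then EBlack else EGray.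

Lemma four_white_ecol_sym u v : four_white_ecol u v = four_white_ecol v u.
Proof. by rewrite /four_white_ecol andbC. Qed.

(* The black edge joins the vertices 0 and 1. *)
Definition four_white : crg 4 :=
  CRG (fun=> VWhite) four_white_ecol_sym.

(* Main.v *)
Require Import Defs.
From mathcomp Require Import all_boot all_order all_algebra.
From mathcomp Require Import all_classical all_reals all_analysis.
From mathcomp Require Import ring lra zify.
Import Order.TTheory GRing.Theory Num.Theory.
Import numFieldNormedType.Exports.
Local Open Scope ring_scope.

Set Implicit Arguments.
Unset Strict Implicit.
Unset Printing Implicit Defensive.

(** The bound and the existence of the limit both rest on averaging over random
    maps ([first_moment]): if every vertex of a graph independently picks a
    value, some choice costs no more than the expected cost.

    Upper bound.  Let [G] have edge density [q], and let [K] be a colored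
    regularity graph with which no map from [H9] conforms.  Partition the
    vertices of [G] at random with weights [u] and repair all pairs that violate
    [K].  The result conforms with [K], hence has no induced [H9], and the
    expected proportion of edited pairs is the quadratic form of [crg_mx K q] at
    [u] ([Dist_le_crg_form]).  With optimal weights the distance of [G] is at
    most [gK K q] times the number of pairs, for every finite [G].  This applies
    to both [two_black] and [four_white], because [H9] conforms with neither
    ([H9_not_two_black], [H9_not_four_white]).  The curves are [(1 - q) / 2],
    decreasing, and [q / 3] up to [1 / 2] followed by [q / (2 * (1 + q))],
    increasing; they meet exactly where [q ^+ 2 = 1 - q], that is at
    [(sqrt 5 - 1) / 2], with value [(3 - sqrt 5) / 4].  The smaller of the two
    never exceeds this value.

    Existence of the limit.  This holds for every hereditary property.  Blow up
    a graph on [n] vertices that is far from the property by a factor [m].  If a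
    graph with the property is near the blow-up, then a random transversal of it
    is near the original graph; so the blow-up has distance at least [m ^ 2]
    times as large ([Dist_blowup]).  Hence the ratio at a large [N] is at least
    the ratio at [n] up to an error [1 / n + 2 * n / N], and a bounded sequence
    with this property converges ([cvg_almost_nondecreasing]). *)

(** * Adjacency and edit counts *)

Lemma set2_inj (T : finType) (x y u v : T) :
  [set x; y]%SET = [set u; v]%SET -> (x, y) = (u, v) \/ (x, y) = (v, u).
Proof.
move=> E.
have := set21 x y; rewrite E !inE.
have := set22 x y; rewrite E !inE.
have := set21 u v; rewrite -E !inE.
have := set22 u v; rewrite -E !inE.
by do 4![case/orP=> /eqP ?]; subst; auto.
Qed.

Lemma adjC (T : finType) (G : sgraph T) x y : adj G x y = adj G y x.
Proof. by rewrite /adj finset.setUC. Qed.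

Lemma adjxx (T : finType) (G : sgraph T) x : adj G x x = false.
Proof.
apply/negP => /(forall_inP (edges_card2 G)).
by rewrite finset.setUid cards1.
Qed.

Lemma adj_graph_of_rel (T : finType) (r : rel T) x y :
  adj (graph_of_rel r) x y = (x != y) && (r x y || r y x).
Proof.
apply/imsetP/andP => [[[u v]]|[xy]].
  rewrite inE /= => /andP[uv ruv] /set2_inj[] [-> ->]; first by rewrite ruv.
  by rewrite eq_sym ruv orbT.
case/orP => rxy; [exists (x, y) | exists (y, x)]; rewrite /= 1?finset.setUC.
- by rewrite inE /= xy.
- by [].
- by rewrite inE /= eq_sym xy.
- by [].
Qed.

(** Edges are counted as ordered pairs of vertices: this turns every count of
    edges or edits into a sum over a product, which can be averaged term by
    term. *)
Lemma double_card_edges (T : finType) (E : {set {set T}}) :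
  (forall e, e \in E -> #|e| = 2%N) ->
  (#|E|.*2 = \sum_(u : T * T) ([set u.1; u.2]%SET \in E))%N.
Proof.
move=> E2; rewrite -big_mkcond /=.
rewrite (partition_big (fun u : T * T => [set u.1; u.2]%SET) (mem E)) //=.
rewrite -muln2 -sum_nat_const; apply: eq_bigr => e eE.
have /cards2P[x [y [xy De]]] : #|e| == 2%N by rewrite E2.
rewrite sum1dep_card; transitivity #|[:: (x, y); (y, x)]|.
  by rewrite (card_uniqP _) //= inE andbT xpair_eqE (negPf xy).
apply: eq_card => -[a b]; rewrite !inE /= De.
apply/idP/andP => [/orP[] /eqP[-> ->]|[_ /eqP/set2_inj[] ->]].
- by split; first by rewrite -De.
- by rewrite [[set y; x]%SET]finset.setUC -De.
- by rewrite eqxx.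
- by rewrite eqxx orbT.
Qed.

Lemma double_edges (T : finType) (G : sgraph T) :
  (#|edges G|.*2 = \sum_(u : T * T | u.1 != u.2) adj G u.1 u.2)%N.
Proof.
rewrite double_card_edges => [|e /(forall_inP (edges_card2 G))/eqP //].
rewrite [RHS]big_mkcond; apply: eq_bigr => -[x y] _ /=.
by case: eqVneq => [->|//]; rewrite -/(adj G y y) adjxx.
Qed.

Lemma double_edit_count (T : finType) (F G : sgraph T) :
  ((edit_count F G).*2 =
     \sum_(u : T * T | u.1 != u.2) (adj F u.1 u.2 != adj G u.1 u.2))%N.
Proof.
rewrite double_card_edges => [|e]; last first.
  by rewrite !inE => /orP[] /andP[_] /(forall_inP (edges_card2 _))/eqP.
rewrite [RHS]big_mkcond; apply: eq_bigr => -[x y] _ /=.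
rewrite !inE -/(adj F x y) -/(adj G x y).
case: eqVneq => [->|_]; first by rewrite !adjxx.
by case: (adj F x y); case: (adj G x y).
Qed.

Lemma double_bin2 n : ('C(n, 2).*2 = n * n.-1)%N.
Proof. by rewrite -mul2n -mul_bin_diag bin1. Qed.

Lemma double_bin2_pairs (T : finType) :
  ('C(#|T|, 2).*2 = \sum_(u : T * T | u.1 != u.2) 1)%N.
Proof.
rewrite double_bin2 -(pair_big_dep xpredT (fun x y => x != y) (fun _ _ => 1%N)).
rewrite /= -sum_nat_const; apply: eq_bigr => x _.
rewrite sum1dep_card -(cardC1 x); apply: eq_card => y.
by rewrite !inE eq_sym.
Qed.

Lemma card_edges_le (T : finType) (G : sgraph T) :
  (#|edges G| <= 'C(#|T|, 2))%N.
Proof.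
rewrite -leq_double double_edges double_bin2_pairs.
by apply: leq_sum => u _; case: adj.
Qed.

Lemma Dist_le (T : finType) (P : graph_class) (F G : sgraph T) :
  P T F -> (Dist G P <= edit_count F G)%N.
Proof. by move=> PF; rewrite -leEnat /Dist -minEnat; apply: bigmin_le_cond. Qed.

Lemma Dist_le_bin2 (T : finType) (P : graph_class) (G : sgraph T) :
  (Dist G P <= 'C(#|T|, 2))%N.
Proof. by rewrite -leEnat /Dist -minEnat; apply: bigmin_le_id. Qed.

(** * The first moment method *)

(** When the values [f v] are chosen independently with law [w], distinct
    vertices receive independent values.  The product over the vertices other
    than [x] and [y] sums to 1. *)
Lemma product_weight_pair (R : comNzRingType) (T S : finType) (w : S -> R)
    (x y : T) (a b : S) :
  \sum_s w s = 1 -> x != y ->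
  \sum_(f : {ffun T -> S}) \prod_v w (f v) * ((f x == a) && (f y == b))%:R
    = w a * w b.
Proof.
move=> w_sum1 xy; have yx : y != x by rewrite eq_sym.
pose sel v s := if v == x then s == a else (v == y) ==> (s == b).
have sum_delta c : \sum_s w s * (s == c)%:R = w c.
  rewrite (bigD1 c) //= eqxx mulr1 big1 ?addr0 // => s /negPf->.
  by rewrite mulr0.
transitivity (\sum_(f : {ffun T -> S}) \prod_v (w (f v) * (sel v (f v))%:R)).
  apply: eq_bigr => f _; rewrite big_split /=; congr (_ * _).
  rewrite (bigD1 x) //= (bigD1 y) //= big1 => [|v].
    rewrite /sel eqxx (negPf yx) eqxx mulr1.
    by case: (f x == a); case: (f y == b); rewrite /= ?mulr1 ?mulr0.
  by rewrite /sel => /andP[/negPf-> /negPf->].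
rewrite -(bigA_distr_bigA (fun v s => w s * (sel v s)%:R)).
rewrite (bigD1 x) //= (bigD1 y) //= [X in _ * (_ * X)]big1 => [|v]; last first.
  move=> /andP[/negPf vx /negPf vy].
  by rewrite -[RHS]w_sum1; apply: eq_bigr => s _; rewrite /sel vx vy mulr1.
rewrite mulr1 /sel eqxx sum_delta; congr (_ * _).
by rewrite -[RHS]sum_delta; apply: eq_bigr => s _; rewrite (negPf yx) eqxx.
Qed.

(** Some map does at least as well as the average over all maps, each weighted
    by the product of its values; with [product_weight_pair] the average of a
    sum of pairwise costs is explicit. *)
Lemma first_moment (R : realDomainType) (T S : finType) (w : S -> R)
    (c : T -> T -> S -> S -> R) :
  (forall a, 0 <= w a) -> \sum_a w a = 1 ->
  exists f : T -> S,
    \sum_(u : T * T | u.1 != u.2) c u.1 u.2 (f u.1) (f u.2)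
    <= \sum_(u : T * T | u.1 != u.2)
         \sum_a \sum_b w a * w b * c u.1 u.2 a b.
Proof.
move=> w_ge0 w_sum1.
pose W (f : {ffun T -> S}) := \prod_x w (f x).
pose X (f : T -> S) := \sum_(u : T * T | u.1 != u.2) c u.1 u.2 (f u.1) (f u.2).
pose E := \sum_(u : T * T | u.1 != u.2)
  \sum_a \sum_b w a * w b * c u.1 u.2 a b.
have W_ge0 f : 0 <= W f by apply: prodr_ge0.
have W_sum1 : \sum_f W f = 1.
  by rewrite -(bigA_distr_bigA (fun=> w)) big1.
have meanX : \sum_(f : {ffun T -> S}) W f * X f = E.
  under eq_bigr => f _ do rewrite mulr_sumr.
  rewrite exchange_big /=; apply: eq_bigr => -[x y] /= xy.
  transitivity (\sum_f \sum_a \sum_b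
      W f * ((f x == a) && (f y == b))%:R * c x y a b).
    apply: eq_bigr => f _; rewrite (bigD1 (f x)) //= (bigD1 (f y)) //= !eqxx.
    rewrite mulr1 [X in _ + X + _]big1 => [|b /negPf fb]; last first.
      by rewrite eq_sym fb mulr0 mul0r.
    rewrite [X in _ + _ + X]big1 ?addr0 // => a /negPf fa.
    by rewrite big1 // => b _; rewrite eq_sym fa mulr0 mul0r.
  rewrite exchange_big; apply: eq_bigr => a _ /=.
  rewrite exchange_big; apply: eq_bigr => b _ /=.
  by rewrite -mulr_suml product_weight_pair.
(* If every map exceeded the mean then all weights would vanish. *)
have [[f XfE]|X_gtE] := boolp.pselect (exists f, X f <= E); first by exists f.
have gtE (f : {ffun T -> S}) : E < X f.
  by rewrite ltNge; apply/negP => XfE; apply: X_gtE; exists f.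
have W0 f : W f = 0.
  have sum0 : \sum_(f : {ffun T -> S}) W f * (X f - E) = 0.
    under eq_bigr => g _ do rewrite mulrBr.
    by rewrite big_split /= sumrN -mulr_suml meanX W_sum1 mul1r subrr.
  have term_ge0 (g : {ffun T -> S}) : true -> 0 <= W g * (X g - E).
    by rewrite mulr_ge0 // subr_ge0 ltW.
  have /eqP : W f * (X f - E) = 0 by apply: (psumr_eq0P term_ge0 sum0).
  by rewrite mulf_eq0 subr_eq0 (gt_eqF (gtE f)) orbF => /eqP.
by have := oner_neq0 R; rewrite -W_sum1 big1 ?eqxx.
Qed.

(** * Hereditary properties and blow-ups *)

Definition pullback (T U : finType) (f : U -> T) (G : sgraph T) : sgraph U :=
  graph_of_rel (fun x y => adj G (f x) (f y)).

Lemma adj_pullback (T U : finType) (f : U -> T) (G : sgraph T) x y :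
  adj (pullback f G) x y = adj G (f x) (f y).
Proof.
rewrite adj_graph_of_rel [adj G (f y) _]adjC orbb.
by case: eqVneq => [->|//]; rewrite adjxx.
Qed.

(** Closure under pulling back along injections combines closure under induced
    subgraphs and under isomorphism. *)
Definition hereditary (P : graph_class) :=
  forall (T U : finType) (f : U -> T) (G : sgraph T),
    injective f -> P T G -> P U (pullback f G).

Lemma Forb_hereditary (U : finType) (H : sgraph U) : hereditary (Forb H).
Proof.
move=> T V f G f_inj; apply: contra => /existsP[g /andP[/injectiveP g_inj gP]].
apply/existsP; exists [ffun x => f (g x)]; apply/andP; split.
  by apply/injectiveP => x y; rewrite !ffunE => /f_inj/g_inj.
apply/forallP => x; apply/forallP => y; rewrite !ffunE -adj_pullback.
by move/forallP: gP => /(_ x)/forallP/(_ y).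
Qed.

Lemma leq_sum_inj (I J : finType) (h : I -> J) (F : J -> nat) :
  injective h -> (\sum_i F (h i) <= \sum_j F j)%N.
Proof.
move=> h_inj; rewrite -(big_imset F (h := h) (A := predT)); last first.
  by move=> x y _ _; apply: h_inj.
rewrite big_mkcond; apply: leq_sum => j _.
by case: ifP.
Qed.

(** [pullback proj G] is the blow-up of [G] in which every vertex [t] becomes
    the cell [phi t], possibly with further vertices.  A graph [F] of [P] close
    to the blow-up restricts, along a random transversal of the cells, to a
    graph of [P] close to [G]: a pair of vertices in distinct cells survives
    with probability [1 / #|S| ^ 2], so some transversal costs at most that
    fraction of the edits. *)
Lemma Dist_blowup (P : graph_class) (T V S : finType)
    (phi : T -> S -> V) (proj : V -> T) (G : sgraph T) :
  hereditary P -> (forall t, injective (phi t)) ->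
  (forall t s, proj (phi t s) = t) ->
  (#|S| ^ 2 * Dist G P <= Dist (pullback proj G) P)%N.
Proof.
move=> hP phi_inj piK.
have Phi_inj : injective (fun u : T * S => phi u.1 u.2).
  move=> [t s] [t' s'] /= E.
  have tt' : t = t' by rewrite -(piK t s) E piK.
  by rewrite -tt' in E *; rewrite (phi_inj _ _ _ E).
have [->|S_gt0] := posnP #|S|; first by rewrite mul0n.
apply: (big_ind (fun d => (#|S| ^ 2 * Dist G P <= d)%N)) => [|d e|F PF].
- (* The default value of the minimum, in case [P] has no graph on [V]. *)
  rewrite (leq_trans (leq_mul (leqnn _) (Dist_le_bin2 _ _))) //.
  rewrite -leq_double doubleMr !double_bin2.
  have leV := leq_card _ Phi_inj; rewrite card_prod in leV.
  have leV' : (#|S| * #|T|.-1 <= #|V|.-1)%N by nia.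
  nia.
- by rewrite leq_min => -> ->.
pose c x y a b : rat :=
  (adj F (phi x a) (phi y b) != adj G x y)%:R.
have S_neq0 : #|S|%:R != 0 :> rat by rewrite pnatr_eq0 -lt0n.
have [||f] := first_moment (w := fun=> #|S|%:R^-1) c.
- by move=> _; rewrite invr_ge0.
- by rewrite sumr_const -[_ *+ _]mulr_natr mulVf.
have f_inj : injective (fun x => phi x (f x)).
  by move=> x y /(congr1 proj); rewrite !piK.
have := Dist_le G (hP _ _ _ _ f_inj PF).
rewrite -leq_double double_edit_count.
under eq_bigr => u _ do rewrite adj_pullback.
rewrite -(ler_nat rat) natr_sum => DG /(le_trans DG) {DG}.
under eq_bigr => u _ do under eq_bigr => a _ do rewrite -mulr_sumr.
under eq_bigr => u _ do rewrite -mulr_sumr.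
rewrite -mulr_sumr -invfM mulrC ler_pdivlMr; last first.
  by rewrite mulr_gt0 // ltr0n.
rewrite -!natrM -leq_double.
have -> : \sum_(u : T * T | u.1 != u.2) \sum_a \sum_b c u.1 u.2 a b
  = (\sum_(u : T * T | u.1 != u.2) \sum_a \sum_b
     (adj F (phi u.1 a) (phi u.2 b) != adj G u.1 u.2))%:R.
  rewrite natr_sum; apply: eq_bigr => u _; rewrite natr_sum.
  by apply: eq_bigr => a _; rewrite natr_sum.
rewrite ler_nat => DG.
rewrite -mulnn doubleMr mulnC.
apply: leq_trans DG _; rewrite double_edit_count.
pose h (z : (T * T) * (S * S)) := (phi z.1.1 z.2.1, phi z.1.2 z.2.2).
have h_inj : injective h.
  move=> [[x y] [a b]] [[x' y'] [a' b']] [].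
  move=> /(Phi_inj (x, a) (x', a'))[-> ->].
  by move=> /(Phi_inj (y, b) (y', b'))[-> ->].
rewrite [leqRHS]big_mkcond /=; apply: leq_trans (leq_sum_inj _ h_inj).
pose F' := pullback proj G.
rewrite -(pair_bigA _ (fun u s => if (h (u, s)).1 != (h (u, s)).2 then
  nat_of_bool (adj F (h (u, s)).1 (h (u, s)).2
               != adj F' (h (u, s)).1 (h (u, s)).2) else 0%N)) /=.
rewrite big_mkcond; apply: leq_sum => -[x y] _ /=; case: eqVneq => // xy.
rewrite pair_bigA; apply: leq_sum => -[a b] _ /=.
rewrite adj_pullback !piK; case: (eqVneq (phi x a)) => [/(congr1 proj)|_].
  by rewrite !piK => /eqP; rewrite (negPf xy).
by [].
Qed.

Lemma Dist_max_le_bin2 (n : nat) (P : graph_class) :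
  (Dist_max n P <= 'C(n, 2))%N.
Proof.
apply/bigmax_leqP => G _.
by rewrite -[X in 'C(X, _)]card_ord Dist_le_bin2.
Qed.

Lemma Dist_max_attained (n : nat) (P : graph_class) :
  exists G : sgraph 'I_n, Dist_max n P = Dist G P.
Proof.
rewrite /Dist_max.
have [|G ->] := bigop.eq_bigmax (fun G : sgraph 'I_n => Dist G P).
  by apply/card_gt0P; exists (graph_of_rel (fun _ _ => false)).
by exists G.
Qed.

(** The vertices of ['I_N] are cut into consecutive intervals of length [m]; the
    first [n] of them are the cells, and the rest of the vertices is put
    anywhere. *)
Lemma Dist_max_blowup (P : graph_class) (n m N : nat) :
  hereditary P -> (n * m <= N)%N -> (m ^ 2 * Dist_max n P <= Dist_max N P)%N.
Proof.
move=> hP nmN; have [n0|n_gt0] := posnP n.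
  rewrite n0; have := Dist_max_le_bin2 0 P.
  by rewrite bin0n leqn0 => /eqP->; rewrite muln0.
have lt_cell (t : 'I_n) (s : 'I_m) : (t * m + s < N)%N.
  apply: leq_trans nmN; apply: leq_trans (_ : t.+1 * m <= _)%N.
    by rewrite mulSn addnC ltn_add2r.
  by rewrite leq_mul2r ltn_ord orbT.
pose phi t s := Ordinal (lt_cell t s).
pose proj (v : 'I_N) : 'I_n := odflt (Ordinal n_gt0) (insub (v %/ m)%N).
have [G ->] := Dist_max_attained n P.
apply: leq_trans (leq_bigmax (pullback proj G)).
rewrite -[X in (X ^ 2 * _)%N]card_ord.
apply: (Dist_blowup (phi := phi)) => // t => [s s' /(congr1 val) /= /addnI|s].
  exact: val_inj.
apply/val_inj; rewrite /proj /= divnMDl; last exact: leq_ltn_trans (ltn_ord s).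
by rewrite divn_small ?addn0 // insubT.
Qed.

(** * Convergence of the edit ratio *)

(** The limit is the supremum of [r n - 1 / n]: the second error term vanishes
    as [N] grows, and [1 / N] does as well. *)
Lemma cvg_almost_nondecreasing (R : realType) (r : R^nat) (M : R) :
  (forall n, r n <= M) ->
  (forall n N, (0 < n)%N -> (0 < N)%N ->
     r n <= r N + n%:R^-1 + 2 * n%:R / N%:R) ->
  cvgn r.
Proof.
move=> r_le almost.
pose A := [set r n - n%:R^-1 | n in [set n | (0 < n)%N]]%classic.
have A_ub : ubound A M.
  move=> _ [n _ <-]; apply: le_trans (r_le n).
  by rewrite lerBlDr lerDl invr_ge0.
have A_sup : has_sup A.
  by split; [exists (r 1%N - 1%:R^-1); exists 1%N | exists M].
apply/cvg_ex; exists (sup A); apply/cvgrPdist_le => e e_gt0.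
have e2_gt0 : 0 < e / 2 by rewrite divr_gt0.
have [_ [n /= n_gt0 <-] near_sup] := sup_adherent e2_gt0 A_sup.
near=> N.
have N_gt0 : (0 < N)%N by near: N; exact: nbhs_infty_gt.
have Ninv : N%:R^-1 <= e.
  near: N; near=> k.
  have : e^-1 < k%:R by near: k; exact: nbhs_infty_gtr.
  move=> /ltW ek; rewrite -[leRHS]invrK lef_pV2 // posrE ?invr_gt0 //.
  by rewrite (lt_le_trans _ ek) ?invr_gt0.
have nN : 2 * n%:R / N%:R <= e / 2.
  near: N; near=> k.
  have kn : 4 * n%:R / e < k%:R by near: k; exact: nbhs_infty_gtr.
  have k_gt0 : 0 < k%:R :> R.
    by apply: le_lt_trans kn; rewrite divr_ge0 ?mulr_ge0 // ltW.
  rewrite ler_pdivrMr //; move: kn; rewrite ltr_pdivrMr //; lra.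
rewrite ler_distlC; apply/andP; split.
  have := almost n N n_gt0 N_gt0; lra.
have : r N - N%:R^-1 <= sup A.
  by apply: sup_upper_bound => //; exists N.
lra.
Unshelve. all: by end_near.
Qed.

Lemma natr_bin2 (R : realFieldType) (n : nat) :
  'C(n, 2)%:R = n%:R * (n%:R - 1) / 2 :> R.
Proof.
have := double_bin2 n => /(congr1 (fun k => k%:R : R)).
rewrite -muln2 !natrM; case: n => [|n] /=; first lra.
rewrite -[n.+1]addn1 natrD; lra.
Qed.

Lemma edit_ratio_ge0 (R : realType) (P : graph_class) n : 0 <= edit_ratio R P n.
Proof. by rewrite /edit_ratio divr_ge0. Qed.

Lemma edit_ratio_le1 (R : realType) (P : graph_class) n : edit_ratio R P n <= 1.
Proof.
rewrite /edit_ratio; have [->|C_gt0] := posnP 'C(n, 2).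
  by rewrite invr0 mulr0.
by rewrite ler_pdivrMr ?ltr0n // mul1r ler_nat Dist_max_le_bin2.
Qed.

(** Blowing up by [m = N %/ n] multiplies the distance by at least [m ^ 2], and
    the number of pairs by slightly more: the ratio at [N] is at least
    [t ^ 2 * (1 - 1 / n)] times the ratio at [n], where [t = m * n / N].  What
    is lost are the pairs inside a cell and those meeting the fewer than [n]
    vertices left over. *)
Lemma edit_ratio_almost_nondecreasing (R : realType) (P : graph_class) n N :
  hereditary P -> (0 < n)%N -> (0 < N)%N ->
  edit_ratio R P n <= edit_ratio R P N + n%:R^-1 + 2 * n%:R / N%:R.
Proof.
move=> hP n_gt0 N_gt0.
have rn_le1 := edit_ratio_le1 R P n; have rn_ge0 := edit_ratio_ge0 R P n.
have rN_ge0 := edit_ratio_ge0 R P N.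
have n_gt0R : 0 < n%:R :> R by rewrite ltr0n.
have N_gt0R : 0 < N%:R :> R by rewrite ltr0n.
have y_ge0 : 0 <= n%:R^-1 :> R by rewrite invr_ge0.
have [Nn|nN] := leqP N n.
  suff : 1 <= n%:R / N%:R :> R by rewrite -mulrA; lra.
  by rewrite ler_pdivlMr // mul1r ler_nat.
pose m := (N %/ n)%N.
pose s : R := n%:R / N%:R; pose t : R := m%:R * s.
have s_ge0 : 0 <= s by rewrite divr_ge0.
have t_ge0 : 0 <= t by rewrite mulr_ge0.
have t_le1 : t <= 1.
  by rewrite /t /s mulrA ler_pdivrMr // mul1r -natrM ler_nat leq_divM.
have t_ge : 1 - s <= t.
  rewrite lerBlDr /t /s -[X in _ + X]mul1r -mulrDl mulrA ler_pdivlMr // mul1r.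
  by rewrite natr1 -natrM ler_nat ltnW // ltn_ceil.
have Dn : (Dist_max n P)%:R = edit_ratio R P n * 'C(n, 2)%:R.
  rewrite /edit_ratio; have [C0|C_gt0] := posnP 'C(n, 2).
    by have := Dist_max_le_bin2 n P; rewrite C0 leqn0 => /eqP->; rewrite mulr0.
  by rewrite divfK // pnatr_eq0 -lt0n.
have CN_gt0 : 0 < 'C(N, 2)%:R :> R.
  by rewrite ltr0n bin_gt0 (leq_ltn_trans n_gt0).
have rN_ge : edit_ratio R P n * (t ^+ 2 * (1 - n%:R^-1)) <= edit_ratio R P N.
  have blow : (m ^ 2 * Dist_max n P <= Dist_max N P)%N.
    by apply: Dist_max_blowup; rewrite // mulnC leq_divM.
  rewrite {2}/edit_ratio ler_pdivlMr //.
  apply: le_trans (_ : (m ^ 2 * Dist_max n P)%:R <= _); last by rewrite ler_nat.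
  rewrite natrM natrX Dn !natr_bin2 [leRHS]mulrCA -[leLHS]mulrA ler_wpM2l //.
  have -> : m%:R ^+ 2 * (n%:R * (n%:R - 1) / 2)
      = t ^+ 2 * (1 - n%:R^-1) * (N%:R * N%:R / 2) :> R.
    by rewrite /t /s; field; rewrite !gt_eqF.
  rewrite ler_wpM2l ?mulr_ge0 ?sqr_ge0 ?subr_ge0 ?invf_le1 ?ler1n //.
  by rewrite ler_wpM2r ?invr_ge0 // ler_wpM2l // lerBlDr lerDl.
have t2_ge : 1 - 2 * s <= t ^+ 2 by nra.
have t2_le1 : t ^+ 2 <= 1 by rewrite expr_le1.
(* [t ^ 2 >= 1 - 2 * s] and [y >= 0] bound the loss; then [r <= 1] applies. *)
rewrite -mulrA -/s.
set y := n%:R^-1 in y_ge0 rN_ge *.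
set r := edit_ratio R P n in rn_le1 rn_ge0 rN_ge *.
suff : r * (1 - t ^+ 2 * (1 - y)) <= y + 2 * s by nra.
have : 1 - t ^+ 2 * (1 - y) <= y + 2 * s by nra.
nra.
Qed.

Lemma cvgn_edit_ratio (R : realType) (P : graph_class) :
  hereditary P -> cvgn (edit_ratio R P).
Proof.
move=> hP; apply: (cvg_almost_nondecreasing (edit_ratio_le1 R P)) => n N.
exact: edit_ratio_almost_nondecreasing.
Qed.

(** * Editing along a colored regularity graph *)

(** The edge colouring of [K], completed on the diagonal by the vertex colours:
    a white vertex asks for an independent set, a black one for a clique. *)
Definition crg_colour (k : nat) (K : crg k) (a b : 'I_k) : ecolor :=
  if a == b then match vcol K a with VWhite => EWhite | VBlack => EBlack end
  else ecol K a b.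

Lemma crg_colourC (k : nat) (K : crg k) a b :
  crg_colour K a b = crg_colour K b a.
Proof.
rewrite /crg_colour eq_sym; case: eqVneq => [-> //|_]; exact: ecol_sym.
Qed.

Lemma crg_mxE (R : realType) (k : nat) (K : crg k) (p : R) a b :
  crg_mx K p a b = match crg_colour K a b with
                   | EWhite => p | EGray => 0 | EBlack => 1 - p end.
Proof.
rewrite /crg_mx mxE /crg_colour; case: eqVneq => // _.
by case: vcol.
Qed.

Definition agrees (e : ecolor) (b : bool) : bool :=
  match e with EWhite => ~~ b | EGray => true | EBlack => b end.

(** The graphs that can be partitioned according to [K] are those with a
    conforming map. *)
Definition conforms (T : finType) (G : sgraph T) (k : nat) (K : crg k)
    (f : T -> 'I_k) : Prop :=
  forall x y, x != y -> agrees (crg_colour K (f x) (f y)) (adj G x y).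

(** A conforming map of [G] restricts to a conforming map of every induced
    subgraph. *)
Lemma Forb_conforms (U T : finType) (H : sgraph U) (G : sgraph T) (k : nat)
    (K : crg k) (f : T -> 'I_k) :
  (forall g : U -> 'I_k, ~ conforms H K g) -> conforms G K f -> Forb H G.
Proof.
move=> noH fG; apply/negP => /existsP[h /andP[/injectiveP h_inj hP]].
apply: (noH (f \o h)) => x y xy /=.
move/forallP: hP => /(_ x)/forallP/(_ y)/eqP<-.
by apply: fG; rewrite (inj_eq h_inj).
Qed.

Definition edge_density (R : realType) (T : finType) (G : sgraph T) : R :=
  #|edges G|%:R / 'C(#|T|, 2)%:R.

Lemma edge_density_itv (R : realType) (T : finType) (G : sgraph T) :
  0 <= edge_density R G <= 1.
Proof.
rewrite /edge_density divr_ge0 //=; have [->|C_gt0] := posnP 'C(#|T|, 2).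
  by rewrite invr0 mulr0.
by rewrite ler_pdivrMr ?ltr0n // mul1r ler_nat card_edges_le.
Qed.

Definition crg_form (R : realType) (k : nat) (K : crg k) (p : R)
  (u : 'cV[R]_k) : R := (u^T *m crg_mx K p *m u) 0 0.

Lemma crg_formE (R : realType) (k : nat) (K : crg k) (p : R) (u : 'cV[R]_k) :
  crg_form K p u = \sum_a \sum_b u a 0 * u b 0 * crg_mx K p a b.
Proof.
rewrite /crg_form mxE exchange_big; apply: eq_bigr => b _ /=.
rewrite mxE mulr_suml; apply: eq_bigr => a _.
by rewrite mxE mulrAC.
Qed.

(** Put each vertex into class [a] with probability [u a], and change the pairs
    that disagree with [K]: between a white pair of classes the edges, between
    a black one the non-edges.  A proportion [q] of all pairs are edges, hence a
    pair with classes [a] and [b] costs on average the entry [(a, b)] of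
    [crg_mx K q]. *)
Lemma Dist_le_crg_form (R : realType) (k : nat) (K : crg k) (P : graph_class)
    (T : finType) (G : sgraph T) (u : 'cV[R]_k) :
  (forall (F : sgraph T) (f : T -> 'I_k), conforms F K f -> P T F) ->
  simplex u ->
  (Dist G P)%:R <= crg_form K (edge_density R G) u * 'C(#|T|, 2)%:R.
Proof.
move=> PK [u_sum1 u_ge0].
pose c x y a b : R := (~~ agrees (crg_colour K a b) (adj G x y))%:R.
have [f fP] := first_moment c u_ge0 u_sum1.
pose F := graph_of_rel (fun x y => match crg_colour K (f x) (f y) with
  | EWhite => false | EGray => adj G x y | EBlack => true end).
have adjF x y : x != y -> adj F x y = match crg_colour K (f x) (f y) with
    | EWhite => false | EGray => adj G x y | EBlack => true end.
  move=> xy; rewrite adj_graph_of_rel xy [crg_colour K (f y) _]crg_colourC.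
  by rewrite [adj G y x]adjC orbb.
have PF : P T F.
  by apply: (PK F f) => x y xy; rewrite adjF //; case: crg_colour.
have pair_cost a b : \sum_(v : T * T | v.1 != v.2) c v.1 v.2 a b
    = crg_mx K (edge_density R G) a b * 'C(#|T|, 2).*2%:R.
  have C_edges : edge_density R G * 'C(#|T|, 2).*2%:R = #|edges G|.*2%:R.
    rewrite -!muln2 !natrM mulrA; congr (_ * _); rewrite /edge_density.
    have [C0|C_gt0] := posnP 'C(#|T|, 2).
      by have := card_edges_le G; rewrite C0 leqn0 => /eqP->; rewrite mulr0.
    by rewrite divfK // pnatr_eq0 -lt0n.
  rewrite crg_mxE /c; case: crg_colour => /=.
  - rewrite C_edges double_edges natr_sum; apply: eq_bigr => v _.
    by rewrite negbK.
  - by rewrite mul0r big1.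
  - rewrite mulrBl mul1r C_edges double_edges double_bin2_pairs.
    rewrite !natr_sum -sumrB.
    by apply: eq_bigr => v _; case: adj; rewrite ?subrr ?subr0.
have : (edit_count F G).*2%:R
    <= crg_form K (edge_density R G) u * 'C(#|T|, 2).*2%:R.
  rewrite double_edit_count natr_sum crg_formE.
  have -> : \sum_(v : T * T | v.1 != v.2)
      (adj F v.1 v.2 != adj G v.1 v.2)%:R
    = \sum_(v : T * T | v.1 != v.2) c v.1 v.2 (f v.1) (f v.2) :> R.
    apply: eq_bigr => -[x y] /= xy; rewrite /c adjF //.
    by case: crg_colour; case: adj.
  apply: le_trans fP _; rewrite exchange_big mulr_suml le_eqVlt.
  apply/orP; left; apply/eqP/eq_bigr => a _; rewrite exchange_big mulr_suml.
  by apply: eq_bigr => b _; rewrite -mulr_sumr pair_cost mulrA.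
rewrite -!muln2 !natrM mulrA ler_pM2r ?ltr0n //; apply: le_trans.
by rewrite ler_nat Dist_le.
Qed.

(** [v] is attained as the minimum defining [gK K p]; unlike [gK] itself, this
    provides the optimal weights. *)
Definition crg_min (R : realType) (k : nat) (K : crg k) (p v : R) : Prop :=
  (exists2 u, simplex u & crg_form K p u = v) /\
  (forall u, simplex u -> v <= crg_form K p u).

Lemma crg_min_gK (R : realType) (k : nat) (K : crg k) (p v : R) :
  crg_min K p v -> gK K p = v.
Proof.
move=> [[u uS uv] v_le]; apply: xget_unique.
  split; first by exists u.
  by move=> _ [w wS <-]; apply: v_le.
move=> w [[u' u'S <-] lb]; apply/le_anti/andP; split; last exact: v_le.
by rewrite -uv; apply: lb; exists u.
Qed.

Lemma Dist_le_crg_min (R : realType) (k : nat) (K : crg k) (P : graph_class)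
    (T : finType) (G : sgraph T) (v : R) :
  (forall (F : sgraph T) (f : T -> 'I_k), conforms F K f -> P T F) ->
  crg_min K (edge_density R G) v -> (Dist G P)%:R <= v * 'C(#|T|, 2)%:R.
Proof. by move=> PK [[u uS <-] _]; apply: Dist_le_crg_form. Qed.

(** * The two curves *)

Lemma sum_I2 (R : nmodType) (F : 'I_2 -> R) : \sum_i F i = F 0 + F 1.
Proof.
rewrite !big_ord_recl big_ord0 addr0.
by congr (F _ + F _); apply/val_inj.
Qed.

Lemma sum_I4 (R : nmodType) (F : 'I_4 -> R) :
  \sum_i F i = F 0 + F 1 + F 2 + F 3.
Proof.
rewrite !big_ord_recl big_ord0 addr0 !addrA.
by congr (F _ + F _ + F _ + F _); apply/val_inj.
Qed.

Lemma two_black_form (R : realType) (p : R) (u : 'cV[R]_2) :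
  crg_form two_black p u = (1 - p) * (u 0 0 ^+ 2 + u 1 0 ^+ 2).
Proof. rewrite crg_formE !sum_I2 !crg_mxE /crg_colour /=; ring. Qed.

Lemma four_white_form (R : realType) (p : R) (u : 'cV[R]_4) :
  crg_form four_white p u
    = p * (u 0 0 ^+ 2 + u 1 0 ^+ 2 + u 2 0 ^+ 2 + u 3 0 ^+ 2)
      + 2 * (1 - p) * (u 0 0 * u 1 0).
Proof. rewrite crg_formE !sum_I4 !crg_mxE /crg_colour /=; ring. Qed.

Lemma two_black_min (R : realType) (p : R) :
  p <= 1 -> crg_min two_black p ((1 - p) / 2).
Proof.
move=> p_le1; split=> [|u [+ _]].
  exists (\col_i 2^-1); last by rewrite two_black_form !mxE; field.
  split=> [|i]; last by rewrite mxE invr_ge0.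
  by rewrite sum_I2 !mxE; field.
rewrite two_black_form sum_I2; set a := u 0 0; set b := u 1 0 => ab.
have sq : 1 / 2 <= a ^+ 2 + b ^+ 2.
  have := sqr_ge0 (a - b); have -> : b = 1 - a by lra.
  nra.
nra.
Qed.

Definition four_white_value (R : realType) (p : R) : R :=
  if p <= 1 / 2 then p / 3 else p / (2 * (1 + p)).

(** The two joined vertices alone contribute a minimum of [p] for [p <= 1 / 2],
    with all weight on one of them, and of [1 / 2] otherwise, with equal
    weights; the other two contribute [p] each, and along gray edges the
    inverses of such minima add up. *)
Lemma four_white_min (R : realType) (p : R) :
  0 <= p <= 1 -> crg_min four_white p (four_white_value p).
Proof.
move=> /andP[p_ge0 p_le1]; rewrite /four_white_value.
case: leP => [p_le2|p_gt2]; split.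
- (* The black edge is too dear here: one of its ends gets no weight. *)
  exists (\col_(i < 4) ((i != 1)%:R / 3)).
    split=> [|i]; last by rewrite mxE divr_ge0.
    by rewrite sum_I4 !mxE /=; field.
  by rewrite four_white_form !mxE /=; field.
- move=> u [+ u_ge0]; rewrite four_white_form sum_I4.
  move: (u_ge0 0) (u_ge0 1).
  set a := u 0 0; set b := u 1 0; set c := u 2 0; set d := u 3 0.
  move=> a_ge0 b_ge0 sum1.
  have ab_ge0 : 0 <= a * b by rewrite mulr_ge0.
  apply: (@le_trans _ _ (p * ((a + b) ^+ 2 + c ^+ 2 + d ^+ 2))); last by nra.
  rewrite ler_wpM2l //.
  have := sqr_ge0 (c - d); have := sqr_ge0 (a + b - (c + d) / 2).
  have -> : a + b = 1 - c - d by lra.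
  nra.
- have p1_neq0 : 1 + p != 0 by apply: lt0r_neq0; lra.
  have p1_ge0 : 0 <= 1 + p by lra.
  (* Class [i] is weighted in inverse proportion to its own cost: the joined
     pair together gets [2 * p] against 1 for each other vertex. *)
  exists (\col_(i < 4) ((if (i < 2)%N then p else 1) / (2 * (1 + p)))).
    split=> [|i]; last by rewrite mxE; case: ifP; rewrite divr_ge0 ?mulr_ge0.
    by rewrite sum_I4 !mxE /=; field.
  by rewrite four_white_form !mxE /=; field.
- move=> u [+ _]; rewrite four_white_form sum_I4.
  set a := u 0 0; set b := u 1 0; set c := u 2 0; set d := u 3 0 => sum1.
  have p1_gt0 : 0 < 2 * (1 + p) by lra.
  set s := a + b.
  apply: (@le_trans _ _ (s ^+ 2 / 2 + p * (1 - s) ^+ 2 / 2)).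
    rewrite ler_pdivrMr //; have := sqr_ge0 (s * (1 + p) - p); nra.
  have cd : p * (1 - s) ^+ 2 / 2 <= p * (c ^+ 2 + d ^+ 2).
    rewrite -mulrA ler_wpM2l //; have := sqr_ge0 (c - d).
    have -> : 1 - s = c + d by (rewrite /s; lra).
    nra.
  have ab : s ^+ 2 / 2 <= p * (a ^+ 2 + b ^+ 2) + 2 * (1 - p) * (a * b).
    have : 0 <= (p - 1 / 2) * (a - b) ^+ 2.
      by rewrite mulr_ge0 ?sqr_ge0 // subr_ge0 ltW.
    rewrite /s; nra.
  lra.
Qed.

(** * The 9-vertex graph fits neither colored regularity graph *)

(** Adjacency in [H9] as a decision on numbers, to be evaluated by computation;
    9 is added so that the truncated difference is the one modulo 9. *)
Definition adj9 (i j : nat) : bool :=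
  ((i + 9 - j) %% 9 \in [:: 1; 2; 7; 8])%N || [&& i != j, 3 %| i & 3 %| j]%N.

Lemma adj_H9 (x y : 'Z_9) : adj H9 x y = adj9 x y.
Proof.
rewrite adj_graph_of_rel.
by case: x => [[|[|[|[|[|[|[|[|[|x]]]]]]]]] x9];
  case: y => [[|[|[|[|[|[|[|[|[|y]]]]]]]]] y9].
Qed.

(** Backtracking search for [n] more colours that continue the partial map [s]
    of the first [size s] vertices; the conditional, unlike the boolean
    conjunction evaluated by value, cuts the search at the first conflict. *)
Fixpoint extendable (k : nat) (K : crg k) (colours : seq 'I_k) (n : nat)
    (s : seq 'I_k) : bool :=
  if n is n'.+1 then
    has (fun a =>
      if all (fun j => agrees (crg_colour K (nth a s j) a) (adj9 j (size s)))
             (iota 0 (size s))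
      then extendable K colours n' (rcons s a) else false) colours
  else true.

(** The search is complete: it cannot miss the restrictions of a conforming map
    to initial segments of the vertices. *)
Lemma conforms_extendable (k : nat) (K : crg k) (colours : seq 'I_k)
    (f : 'Z_9 -> 'I_k) :
  (forall a, a \in colours) -> conforms H9 K f -> extendable K colours 9 [::].
Proof.
move=> all_colours fH.
suff ext n i : (i + n = 9)%N ->
    extendable K colours n (mkseq (fun j => f (inord j)) i).
  exact: (ext 9%N 0%N).
elim: n i => [//|n IHn] i in9.
apply/hasP; exists (f (inord i)); first exact: all_colours.
rewrite -/extendable -(mkseqS (fun j => f (inord j))) IHn ?addSnnS //.
rewrite (_ : all _ _ = true) // size_mkseq; apply/allP => j.
rewrite mem_iota add0n => /andP[_ ji].
have j9 : (j < 9)%N by lia.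
have i9 : (i < 9)%N by lia.
rewrite nth_mkseq // -{2}(inordK j9) -{2}(inordK i9) -adj_H9; apply: fH.
by rewrite -val_eqE /= !inordK // ltn_eqF.
Qed.

(** The independent triple [1, 4, 7] cannot be covered by two cliques. *)
Lemma H9_not_two_black (f : 'Z_9 -> 'I_2) : ~ conforms H9 two_black f.
Proof.
have all_colours (a : 'I_2) : a \in [:: 0; 1].
  by case: a => [[|[|a]] a2].
by move/(conforms_extendable all_colours); apply/negP; vm_compute.
Qed.

(** The only independent triples are [1, 4, 7] and [2, 5, 8], and they cannot
    both be classes since [0, 3, 6] is a triangle.  So one triple and three
    pairs are the classes, and no two of these are completely joined. *)
Lemma H9_not_four_white (f : 'Z_9 -> 'I_4) : ~ conforms H9 four_white f.
Proof.
have all_colours (a : 'I_4) : a \in [:: 0; 1; 2; 3].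
  by case: a => [[|[|[|[|a]]]] a4].
by move/(conforms_extendable all_colours); apply/negP; vm_compute.
Qed.

(** * The crossing point and the bound *)

(** The abscissa at which the two curves meet, the inverse of the golden
    ratio. *)
Definition crossing (R : realType) : R := (Num.sqrt 5 - 1) / 2.

Lemma crossing_sqr (R : realType) : crossing R ^+ 2 = 1 - crossing R.
Proof.
have : Num.sqrt 5 ^+ 2 = 5 :> R by rewrite sqr_sqrtr.
rewrite /crossing; set r := Num.sqrt 5 => r2; nra.
Qed.

Lemma crossing_gt (R : realType) : 1 / 2 < crossing R.
Proof.
suff : 2 < Num.sqrt 5 :> R by rewrite /crossing; lra.
have r2 : Num.sqrt 5 ^+ 2 = 5 :> R by rewrite sqr_sqrtr.
have := sqrtr_ge0 (5 : R); nra.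
Qed.

Lemma crossing_le1 (R : realType) : crossing R <= 1.
Proof. have := crossing_sqr R; have := sqr_ge0 (crossing R); lra. Qed.

Lemma crossing_value (R : realType) :
  (3 - Num.sqrt 5) / 4 = (1 - crossing R) / 2.
Proof. by rewrite /crossing; field. Qed.

Lemma four_white_value_eq (R : realType) (p : R) : 0 <= p ->
  ((1 - p) / 2 = four_white_value p) <-> p = crossing R.
Proof.
move=> p_ge0; have g_sqr := crossing_sqr R; have g_gt := crossing_gt R.
rewrite /four_white_value; case: leP => p2; split; try lra.
- have p1 : 1 + p != 0 by apply: lt0r_neq0; lra.
  move=> /(congr1 (fun t => t * (2 * (1 + p)))).
  rewrite divfK ?mulf_neq0 // => E.
  have /eqP : (p - crossing R) * (p + crossing R + 1) = 0 by nra.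
  rewrite mulf_eq0 => /orP[/eqP|/eqP]; lra.
- move=> ->; apply: (mulIf (x := 2 * (1 + crossing R))).
    by apply: lt0r_neq0; lra.
  rewrite divfK; first nra.
  by apply: lt0r_neq0; lra.
Qed.

Lemma four_white_value_le (R : realType) (p : R) :
  0 <= p <= crossing R -> four_white_value p <= (1 - crossing R) / 2.
Proof.
move=> /andP[p_ge0 p_le].
have g_sqr := crossing_sqr R; have g_gt := crossing_gt R.
rewrite /four_white_value; case: (leP p) => p2.
  have := crossing_le1 R; nra.
rewrite ler_pdivrMr; nra.
Qed.

(** One curve decreases and the other increases, so at every edge density the
    lower of the two is at most their common value at [crossing]. *)
Lemma Dist_H9_le (R : realType) (T : finType) (G : sgraph T) :
  (Dist G (Forb H9))%:R <= (1 - crossing R) / 2 * 'C(#|T|, 2)%:R.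
Proof.
have /andP[q_ge0 q_le1] := edge_density_itv R G.
set q := edge_density R G in q_ge0 q_le1.
have [q_ge|q_lt] := leP (crossing R) q.
  have := Dist_le_crg_min (P := Forb H9) (G := G) _ (two_black_min q_le1).
  move=> /(_ (fun F f => Forb_conforms H9_not_two_black)) /le_trans; apply.
  by rewrite ler_wpM2r // ler_wpM2r ?invr_ge0 // lerB.
have q01 : 0 <= q <= 1 by rewrite q_ge0.
have := Dist_le_crg_min (P := Forb H9) (G := G) _ (four_white_min q01).
move=> /(_ (fun F f => Forb_conforms H9_not_four_white)) /le_trans; apply.
by rewrite ler_wpM2r // four_white_value_le // q_ge0 ltW.
Qed.

Lemma edit_ratio_H9_le (R : realType) (n : nat) :
  edit_ratio R (Forb H9) n <= (1 - crossing R) / 2.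
Proof.
have v_ge0 : 0 <= (1 - crossing R) / 2.
  by rewrite divr_ge0 // subr_ge0 crossing_le1.
rewrite /edit_ratio; have [->|C_gt0] := posnP 'C(n, 2).
  by rewrite invr0 mulr0.
rewrite ler_pdivrMr ?ltr0n //; have [G ->] := Dist_max_attained n (Forb H9).
by have := Dist_H9_le R G; rewrite card_ord.
Qed.

Theorem theorem14 (R : realType) :
  [/\ cvgn (edit_ratio R (Forb H9)),
      dstar R (Forb H9) <= (3 - Num.sqrt 5) / 4
    & exists p : R,
        [/\ 0 <= p <= 1,
            gK two_black p = (3 - Num.sqrt 5) / 4,
            gK four_white p = (3 - Num.sqrt 5) / 4
          & forall q : R, 0 <= q <= 1 ->
              gK two_black q = gK four_white q -> q = p] ].
Proof.
have cvg_ratio : cvgn (edit_ratio R (Forb H9)).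
  exact/cvgn_edit_ratio/Forb_hereditary.
have g_ge0 : 0 <= crossing R by have := crossing_gt R; lra.
have g01 : 0 <= crossing R <= 1 by rewrite g_ge0 crossing_le1.
split=> //.
  apply: limr_le => //; apply: nearW => n.
  by rewrite crossing_value edit_ratio_H9_le.
exists (crossing R); split=> //.
- by rewrite crossing_value (crg_min_gK (two_black_min (crossing_le1 R))).
- rewrite crossing_value (crg_min_gK (four_white_min g01)).
  by apply/esym/four_white_value_eq.
- move=> q q01; have /andP[q_ge0 q_le1] := q01.
  rewrite (crg_min_gK (two_black_min q_le1)) (crg_min_gK (four_white_min q01)).
  by move/(four_white_value_eq q_ge0).
Qed.
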